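(* Let $G$ be a finite group with center $Z(G)$. Then $$\alpha(G)\leq\alpha(Z(G)),$$ and equality $\alpha(G)=\alpha(Z(G))$ holds if and only if $G\cong G_1\times G_2$, where $G_1$ is a $2$-group with $G_1=\Omega_{\{1\}}(G_1)Z(G_1)$ and $G_2$ is an abelian group of odd order.
   Context: For a finite group $H$, $C(H)$ denotes the set of cyclic subgroups of $H$ and $\alpha(H)=\frac{|C(H)|}{|H|}$. $Z(H)$ denotes the center of $H$. For a finite $2$-group $G_1$, $\Omega_{\{1\}}(G_1)=\{x\in G_1 \mid x^2=1\}$ is the set (not the subgroup generated by it) of elements of order $1$ or $2$, and $\Omega_{\{1\}}(G_1)Z(G_1)=\{xz \mid x\in\Omega_{\{1\}}(G_1),\ z\in Z(G_1)\}$ is the product of subsets; thus the condition $G_1=\Omega_{\{1\}}(G_1)Z(G_1)$ means that $G_1$ has a transversal modulo $Z(G_1)$ consisting only of elements of order $1$ or $2$. A $2$-group is a finite group whose order is a power of $2$; trivial groups are allowed for $G_1$ and $G_2$. *)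

(* Defs.v *)
From HB Require Import structures.
From mathcomp Require Import all_boot all_order all_algebra all_fingroup all_solvable.

Set Implicit Arguments.
Unset Strict Implicit.
Unset Printing Implicit Defensive.

Import Order.TTheory GRing.Theory Num.Theory.
Import GroupScope.

Definition cyclic_subgroups (gT : finGroupType) (H : {group gT}) : {set {group gT}} :=
  [set K in subgroups H | cyclic K].

Definition alpha (gT : finGroupType) (H : {group gT}) : rat :=
  (#|cyclic_subgroups H|%:R / #|H|%:R)%R.

(* The set of solutions of x ^+ 2 = 1, not the subgroup 'Ohm_1(H) it generates. *)
Definition Omega_set (gT : finGroupType) (H : {group gT}) : {set gT} :=
  [set x in H | x ^+ 2 == 1].

(* Main.v *)
Require Import Defs.
From mathcomp Require Import all_boot all_order all_algebra all_fingroup all_solvable.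

Set Implicit Arguments.
Unset Strict Implicit.
Unset Printing Implicit Defensive.

Import Order.TTheory GRing.Theory Num.Theory.
Import GroupScope.

(** Let N be an even multiple of the exponent of G. Raising to powers gives an
    action of the units u of Z/N on G whose orbits are the sets of generators
    of the cyclic subgroups of G, so by Burnside's lemma the number of cyclic
    subgroups of G is the average over u of the number of solutions in G of
    x ^ u = x; the same holds for every subgroup of G, with the same N. This is
    [burnside_cyclic].

    Let Z be a central subgroup. For fixed u, if t solves the equation then the
    solutions in the coset Zt are the zt with z a solution in Z. So every coset
    contains either no solution or exactly as many as Z, and G has at most
    |G : Z| times as many solutions as Z, with equality iff every coset of Z
    contains a solution ([card_fixed_powers]). Averaging over u gives
    alpha(G) <= alpha(Z), with equality iff for each u every coset contains a
    solution. Now u is odd because N is even, so every x with x ^ 2 = 1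
    satisfies x ^ u = x, and for u = -1 there are no other solutions. Hence
    equality holds iff every coset of Z contains some x with x ^ 2 = 1
    ([card_cyclic_central], [alpha_central]).

    Take Z = Z(G). In the equality case all squares are central, so G / Z(G) is
    elementary abelian and G is nilpotent, the direct product of its Sylow
    2-subgroup, which inherits the condition, and of 'O_2^'(G), where each
    element is a power of its own square and is therefore central
    ([mul_center_Omega_decomp]). Conversely, the condition passes from G1 to
    G1 x G2 when G2 is abelian ([mul_center_Omega_setX]). *)

(** * Units modulo n acting by powers *)

(** When m divides n, this says that reduction from units modulo n to units
    modulo m is onto. By the Chinese remainder theorem there is a u congruent to
    k modulo m, hence prime to the primes of m, and congruent to 1 modulo the
    part of n prime to m. *)
Lemma coprime_lift (m n k : nat) :
  0 < m -> 0 < n -> coprime m k ->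
  exists2 u, u = k %[mod m] & coprime n u.
Proof.
move=> m_gt0 n_gt0 co_mk; pose n' := (n`_(\pi(m)^'))%N.
have n'_gt0 : 0 < n' by rewrite part_gt0.
have co_mn' : coprime m n' by rewrite coprime_pi' // part_pnat.
(* The summand m * n' only makes u nonzero. *)
pose u := (m * n' + chinese m n' k 1)%N.
have u_gt0 : 0 < u by rewrite addn_gt0 muln_gt0 m_gt0 n'_gt0.
have u_k : u = k %[mod m] by rewrite /u mulnC modnMDl chinese_modl.
have u_1 : u = 1 %[mod n'] by rewrite /u modnMDl chinese_modr.
exists u => //; rewrite -(partnC \pi(m) n_gt0) coprimeMl; apply/andP; split.
  apply: pnat_coprime (part_pnat _ _) _.
  by rewrite -coprime_pi' // -coprime_modr u_k coprime_modr.
by rewrite -/n' -coprime_modr u_1 coprime_modr coprimen1.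
Qed.

Section Powers.

Variable gT : finGroupType.
Implicit Types (x y : gT) (G H Z : {group gT}).

(** A modulus that depends only on the ambient group serves all subgroups at
    once; the factor 2 makes every unit odd, so that groups of odd order need
    no separate treatment. *)
Definition modulus : nat := (2 * #|[set: gT]|)%N.

Lemma modulus_gt1 : 1 < modulus.
Proof. by rewrite /modulus mul2n -addnn -addn1 leq_add // cardG_gt0. Qed.

Lemma expg_modulus x k : x ^+ (k %% modulus) = x ^+ k.
Proof.
by apply: expg_mod; rewrite /modulus mulnC expgM expg_cardG ?inE // expg1n.
Qed.

Definition unit_power x (u : {unit 'Z_modulus}) : gT := x ^+ (val u : 'Z_modulus).

Lemma unit_power1 x : unit_power x 1 = x.
Proof. by rewrite /unit_power /= modn_small // expg1. Qed.

Lemma unit_powerM x : act_morph unit_power x.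
Proof.
move=> u v; rewrite /unit_power /= -expgM.
by rewrite [X in _ %% X](Zp_cast modulus_gt1) expg_modulus.
Qed.

Definition power_action := TotalAction unit_power1 unit_powerM.

Local Notation U := [set: {unit 'Z_modulus}].

Lemma unit_powerP n : coprime modulus n ->
  exists u : {unit 'Z_modulus}, forall x, unit_power x u = x ^+ n.
Proof.
move=> co_n.
have Un : (n%:R : 'Z_modulus)%R \is a GRing.unit.
  by rewrite unitZpE ?modulus_gt1.
exists (FinRing.unit 'Z_modulus Un) => x.
by rewrite /unit_power /= val_Zp_nat ?modulus_gt1 // expg_modulus.
Qed.

Lemma coprime_unit (u : {unit 'Z_modulus}) :
  coprime modulus (val u : 'Z_modulus).
Proof. by rewrite -unitZpE ?modulus_gt1 // natr_Zp; apply: valP. Qed.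

Lemma unit_odd (u : {unit 'Z_modulus}) : odd (val u : 'Z_modulus).
Proof.
by have := coprime_unit u; rewrite /modulus coprimeMl coprime2n => /andP[].
Qed.

(** A generator of <[x]> is a power x ^+ k with k prime to the order of x, and
    such a k lifts to a unit for the modulus. *)
Lemma orbit_power x : orbit power_action U x = [set y | generator <[x]> y].
Proof.
apply/setP=> y; rewrite inE; apply/imsetP/idP=> [[u _ ->] | gen_y].
  rewrite /= /unit_power generator_coprime.
  apply: coprime_dvdl (coprime_unit u).
  by rewrite /modulus dvdn_mull // order_dvdG ?inE.
have /cycleP[k def_y] : y \in <[x]> by rewrite cycle_generator.
rewrite def_y generator_coprime in gen_y.
have modulus_gt0 : 0 < modulus := ltnW modulus_gt1.
have [n eq_nk /unit_powerP[u xu]] := coprime_lift (order_gt0 x) modulus_gt0 gen_y.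
exists u; rewrite ?inE //= xu def_y.
by apply/eqP; rewrite eq_expg_mod_order eq_nk.
Qed.

(** A cyclic subgroup is determined by its set of generators, which is an orbit
    of the power action. *)
Lemma card_cyclic_subgroups H :
  #|orbit power_action U @: H| = #|cyclic_subgroups H|.
Proof.
pose gens (K : {group gT}) := [set y | generator K y].
have -> : orbit power_action U @: H = gens @: cyclic_subgroups H.
  apply/setP=> O; apply/imsetP/imsetP=> [[x Hx ->] | [K]].
    exists <[x]>%G; last exact: orbit_power.
    by rewrite !inE /= cycle_subG Hx cycle_cyclic.
  rewrite !inE => /andP[sKH /cyclicP[x defK]] ->; exists x.
    by rewrite -cycle_subG -defK.
  by rewrite orbit_power /gens defK.
apply: card_in_imset => K L; rewrite !inE => /andP[_ /cyclicP[x defK]] _ eqKL.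
have : x \in gens K by rewrite inE defK generator_cycle.
rewrite eqKL inE => /eqP defL; apply: val_inj.
by rewrite /= defK defL.
Qed.

(** * Solutions of x ^ u = x in a group and in a central subgroup *)

Definition fixed_powers (u : {unit 'Z_modulus}) (H : {set gT}) : {set gT} :=
  'Fix_(H | power_action)[u].

Lemma fixed_powersP u (H : {set gT}) x :
  reflect (x \in H /\ x ^+ (val u : 'Z_modulus) = x) (x \in fixed_powers u H).
Proof.
apply: (iffP setIP) => -[Hx].
  by move/afix1P.
by move=> xu; split=> //; apply/afix1P.
Qed.

Lemma burnside_cyclic H :
  (#|cyclic_subgroups H| * #|U| = \sum_(u in U) #|fixed_powers u H|)%N.
Proof.
rewrite -card_cyclic_subgroups -Frobenius_Cauchy //.
apply/actsP=> u _ x /=; rewrite /unit_power.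
apply/idP/idP=> [Hxu | /groupX]; last exact.
have : x \in orbit power_action U (power_action x u).
  by rewrite orbit_sym mem_orbit.
by rewrite orbit_power inE => /cycle_generator/cycleP[i ->]; rewrite groupX.
Qed.

(** For central z, (z * t) ^ u = z ^ u * t ^ u; so once t satisfies t ^ u = t,
    the solutions in the coset of t are the translates by t of those in Z. The
    bound counts the cosets that contain a solution. *)
Lemma card_fixed_powers u G Z : Z \subset 'Z(G) ->
  #|fixed_powers u G| <= #|fixed_powers u Z| * #|G : Z|
     ?= iff (G \subset Z * fixed_powers u G).
Proof.
move=> sZZG; have [sZG cZG] := subsetIP sZZG.
set FG := fixed_powers u G; set FZ := fixed_powers u Z.
have sFG : FG \subset G by apply: subsetIl.
have F1 : 1 \in FZ by apply/fixed_powersP; rewrite group1 expg1n.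
have FZ_gt0 : 0 < #|FZ| by apply/card_gt0P; exists 1.
have fiber t : t \in FG -> [set x in FG | Z :* x == Z :* t] = FZ :* t.
  move=> /fixed_powersP[Gt tu]; apply/setP=> x; rewrite mem_rcoset.
  have cZt z : z \in Z -> commute z t.
    by move=> Zz; apply: (centP (subsetP cZG z Zz)).
  rewrite inE; apply/andP/fixed_powersP=> [[/fixed_powersP[Gx xu]] | [Zxt]].
    move/eqP/rcoset_eqP; rewrite mem_rcoset => Zxt; split=> //.
    have := expgMn (val u : 'Z_modulus) (cZt _ Zxt).
    by rewrite mulgKV tu xu => /(canLR (mulgK _)).
  have def_x : x = x * t^-1 * t by rewrite mulgKV.
  move=> xtu; split; last by apply/eqP/rcoset_eqP; rewrite mem_rcoset.
  apply/fixed_powersP; split; first by rewrite def_x groupM // (subsetP sZG).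
  by rewrite def_x expgMn ?xtu ?tu //; apply: cZt.
have -> : #|FG| = (#|FZ| * #|rcosets Z FG|)%N.
  rewrite -[LHS]sum1_card (partition_big_imset (rcoset Z)) /=.
  rewrite mulnC -sum_nat_const; apply: eq_bigr => _ /rcosetsP[t FGt ->].
  rewrite -(card_rcoset FZ t) -(fiber t FGt) -sum1_card.
  by apply: eq_bigl => x; rewrite [RHS]inE rcosetE.
have sub_cosets : (rcosets Z G \subset rcosets Z FG) = (G \subset Z * FG).
  apply/subsetP/subsetP=> [sGF x Gx | sGF _ /rcosetsP[x Gx ->]].
    by rewrite -mem_rcosets sGF // mem_rcosets (subsetP (mulG_subr _ _)).
  by rewrite mem_rcosets sGF.
have [le_card eq_card] : #|rcosets Z FG| <= #|G : Z| ?= iff (G \subset Z * FG).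
  by rewrite -sub_cosets; apply: subset_leqif_card; apply: imsetS.
by split; rewrite ?leq_pmul2l ?eqn_pmul2l.
Qed.

(** Summing over u gives the inequality, and equality iff the condition on
    cosets holds for every u. As each u is odd, a solution of w ^ 2 = 1 solves
    all the equations w ^ u = w, while for u = -1 the two equations agree. *)
Lemma card_cyclic_central G Z : Z \subset 'Z(G) ->
  #|cyclic_subgroups G| <= #|cyclic_subgroups Z| * #|G : Z|
     ?= iff (G \subset Z * Omega_set G).
Proof.
move=> sZZG; have U_gt0 : 0 < #|U| by apply: cardG_gt0.
have -> : (G \subset Z * Omega_set G) =
    [forall (u | u \in U), G \subset Z * fixed_powers u G].
  apply/idP/forall_inP=> [sGO u _ | sGF].
    apply: subset_trans sGO (mulgS _ _); apply/subsetP=> w.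
    rewrite inE => /andP[Gw /eqP w2]; apply/fixed_powersP; split=> //.
    rewrite -[_ (val u)]odd_double_half unit_odd -mul2n.
    by rewrite expgS expgM w2 expg1n mulg1.
  (* The unit u is -1, so that w ^ u = w reads w^-1 = w. *)
  have [|u xu] := @unit_powerP modulus.-1.
    by rewrite coprimenP // ltnW ?modulus_gt1.
  apply: subset_trans (sGF u _) (mulgS _ _); rewrite ?inE //.
  apply/subsetP=> w /fixed_powersP[Gw wu]; rewrite inE Gw /=.
  have: unit_power w u = w by [].
  rewrite xu => w_inv; apply/eqP; rewrite expgS expg1 -{1}w_inv -expgSr.
  rewrite prednK ?(ltnW modulus_gt1) //.
  by rewrite -expg_modulus modnn.
have := leqif_sum (fun u (_ : u \in U) => card_fixed_powers u sZZG).
rewrite -big_distrl -!burnside_cyclic /= mulnAC => -[le_sum eq_sum].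
by split; [rewrite -(leq_pmul2r U_gt0) | rewrite -eq_sum eqn_pmul2r].
Qed.

End Powers.

(** * The inequality for alpha *)

Lemma alpha_central (gT : finGroupType) (G Z : {group gT}) : Z \subset 'Z(G) ->
  (alpha G <= alpha Z ?= iff (G \subset Z * Omega_set G)%g)%R.
Proof.
move=> sZZG; have sZG : Z \subset G := subset_trans sZZG (center_sub G).
have [le_card eq_card] := card_cyclic_central sZZG.
have G_gt0 : (0 < #|G|%:R :> rat)%R by rewrite ltr0n.
have Z_gt0 : (0 < #|Z|%:R :> rat)%R by rewrite ltr0n.
have alphaZ : (alpha Z * #|G|%:R = (#|cyclic_subgroups Z| * #|G : Z|)%:R)%R.
  rewrite /alpha -(Lagrange sZG) !natrM mulrA divfK ?gt_eqF //.
have alphaG : (alpha G * #|G|%:R = #|cyclic_subgroups G|%:R)%R.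
  by rewrite /alpha divfK ?gt_eqF.
split; first by rewrite -(ler_pM2r G_gt0) alphaG alphaZ ler_nat.
rewrite -eq_card -(eqr_nat rat) -alphaG -alphaZ.
by rewrite (inj_eq (mulIf (lt0r_neq0 G_gt0))).
Qed.

(** * Groups in which every coset of the center contains an involution or 1 *)

Lemma mul_center_OmegaP (gT : finGroupType) (G : {group gT}) :
  reflect (forall x, x \in G -> exists2 z, z \in 'Z(G) & (x * z) ^+ 2 = 1)
          (G \subset 'Z(G) * Omega_set G).
Proof.
apply: (iffP subsetP) => [sGO x Gx | GO x Gx].
  have /mulsgP[z w Zz + ->] := sGO x Gx; rewrite inE => /andP[Gw /eqP w2].
  exists z^-1; rewrite ?groupV //.
  by have [_ /(_ w Gw) zw] := centerP _ _ Zz; rewrite zw mulgK.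
have [z Zz xz2] := GO x Gx; have [Gz cGz] := centerP _ _ Zz.
apply/mulsgP; exists z^-1 (x * z); rewrite ?groupV //.
  by rewrite inE groupM //= xz2.
by rewrite -(cGz x Gx) mulKg.
Qed.

Lemma mul_Omega_center (gT : finGroupType) (G : {group gT}) :
  G :=: Omega_set G * 'Z(G) <-> G \subset 'Z(G) * Omega_set G.
Proof.
have sOG : Omega_set G \subset G by apply/subsetP=> x /[1!inE] /andP[].
have <- : Omega_set G * 'Z(G) = 'Z(G) * Omega_set G.
  by apply: centC; rewrite (subset_trans sOG) // centsC subsetIr.
split=> [{1}-> // | sGO]; apply/eqP; rewrite eqEsubset sGO.
by rewrite mul_subG ?center_sub.
Qed.

Lemma mul_center_Omega_isog (aT rT : finGroupType)
    (G : {group aT}) (H : {group rT}) :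
  G \isog H -> G \subset 'Z(G) * Omega_set G -> H \subset 'Z(H) * Omega_set H.
Proof.
case/isogP=> f injf defH /mul_center_OmegaP GO.
have {defH} -> : H = (f @* G)%G by apply: val_inj.
apply/mul_center_OmegaP=> _ /morphimP[x Gx _ ->].
have [z Zz xz2] := GO x Gx; have Gz := subsetP (center_sub G) z Zz.
exists (f z); first by rewrite -(injm_center injf) // mem_morphim.
by rewrite -morphM // -morphX ?groupM // xz2 morph1.
Qed.

(** Over (x, y) the second coordinate is cancelled by the central (1, y^-1). *)
Lemma mul_center_Omega_setX (gT1 gT2 : finGroupType)
    (G1 : {group gT1}) (G2 : {group gT2}) :
    G1 \subset 'Z(G1) * Omega_set G1 -> abelian G2 ->
  setX G1 G2 \subset 'Z(setX G1 G2) * Omega_set (setX G1 G2).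
Proof.
move=> /mul_center_OmegaP GO abG2.
apply/mul_center_OmegaP=> -[x y] /setXP[/= Gx Gy].
have [z Zz xz2] := GO x Gx; have [Gz cGz] := centerP _ _ Zz.
exists (z, y^-1).
  apply/centerP; split=> [|[a b] /setXP[/= Ga Gb]].
    by rewrite inE /= Gz groupV.
  congr (_, _); first exact: cGz.
  by apply: (centsP abG2); rewrite ?groupV.
rewrite expgS expg1; congr (_, _); first exact: xz2.
by rewrite /= mulgV mulg1.
Qed.

(** If (x z)^2 = 1 with z central, then x^2 = z^-2. *)
Lemma sqr_in_center (gT : finGroupType) (G : {group gT}) x :
  G \subset 'Z(G) * Omega_set G -> x \in G -> x ^+ 2 \in 'Z(G).
Proof.
move=> /mul_center_OmegaP GO Gx.
have [z Zz] := GO x Gx; have [Gz cGz] := centerP _ _ Zz.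
rewrite expgMn; last by apply/commute_sym/cGz.
move/eqP; rewrite -eq_invg_mul => /eqP defx.
by rewrite -groupV defx groupX.
Qed.

(** All squares are central, so G / 'Z(G) has exponent dividing 2 and is
    therefore abelian. *)
Lemma mul_center_Omega_nil (gT : finGroupType) (G : {group gT}) :
  G \subset 'Z(G) * Omega_set G -> nilpotent G.
Proof.
move=> GO; rewrite -quotient_center_nil; apply/abelian_nil.
apply: (@abelem_abelian _ 2); apply: exponent2_abelem.
apply/exponentP=> _ /morphimP[x Nx Gx ->].
by rewrite -morphX //; apply: coset_id; apply: sqr_in_center.
Qed.

(** In 'O_2(G), writing x * z = w with z central in G and w ^ 2 = 1, both w and
    then z lie in 'O_2(G). In 'O_2^'(G) squaring is invertible and its values
    are central, so the whole subgroup is central. *)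
Lemma mul_center_Omega_decomp (gT : finGroupType) (G : {group gT}) :
    G \subset 'Z(G) * Omega_set G ->
  [/\ G \isog setX 'O_2(G) 'O_2^'(G),
      'O_2(G) \subset 'Z('O_2(G)) * Omega_set 'O_2(G)
    & abelian 'O_2^'(G)].
Proof.
move=> GO; have nilG := mul_center_Omega_nil GO.
split; first by rewrite isog_sym; apply/misom_isog/mulgmP/nilpotent_pcoreC.
  have sPG := pcore_sub 2 G; apply/mul_center_OmegaP=> x Px.
  have [z Zz xz2] := mul_center_OmegaP _ GO x (subsetP sPG x Px).
  have [Gz cGz] := centerP _ _ Zz.
  have Pxz : x * z \in 'O_2(G).
    rewrite (mem_normal_Hall (nilpotent_pcore_Hall 2 nilG)) ?pcore_normal //.
      by apply: (@pnat_dvd _ 2); rewrite // order_dvdn xz2.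
    by rewrite groupM // (subsetP sPG).
  exists z => //; apply/centerP; split; first by rewrite -(groupMl _ Px).
  by move=> y Py; apply: cGz; apply: (subsetP sPG).
have sZ : 'O_2^'(G) \subset 'Z(G).
  apply/subsetP=> x Qx; have Gx := subsetP (pcore_sub _ _) x Qx.
  have co_x2 : coprime #|'O_2^'(G)| 2.
    by rewrite coprimen2 odd_2'nat; apply: pcore_pgroup.
  rewrite -(expgK co_x2 Qx); apply: groupX.
  exact: sqr_in_center.
by apply: abelianS sZ (center_abelian G).
Qed.

Theorem theorem1 (gT : finGroupType) (G : {group gT}) :
  (alpha G <= alpha 'Z(G)%G)%R /\
  (alpha G = alpha 'Z(G)%G <->
   exists (gT1 gT2 : finGroupType) (G1 : {group gT1}) (G2 : {group gT2}),
     [/\ G \isog setX G1 G2,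
         2.-group G1,
         G1 :=: Omega_set G1 * 'Z(G1),
         abelian G2
       & odd #|G2| ]).
Proof.
have [le_alpha eq_alpha] := alpha_central (subxx 'Z(G)).
split=> //; split=> [/eqP|].
  rewrite eq_alpha => /mul_center_Omega_decomp[isoG PO abQ].
  exists gT, gT, 'O_2(G)%G, 'O_2^'(G)%G; split=> //.
  - exact: pcore_pgroup.
  - exact/mul_Omega_center.
  - by rewrite odd_2'nat; apply: pcore_pgroup.
case=> gT1 [gT2 [G1 [G2 [isoG _ /mul_Omega_center G1O abG2 _]]]].
apply/eqP; rewrite eq_alpha.
have := mul_center_Omega_setX G1O abG2.
by apply: mul_center_Omega_isog; rewrite isog_sym.
Qed.
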